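(* There exist $r_1,r_2\in H^\infty$ and $f_1,f_2\in A^2$ with $r_1f_1+r_2f_2=0$ such that there do not exist $k\in\mathbb{N}$, $\theta_{ij}\in H^\infty$ ($1\le i\le 2$, $1\le j\le k$), and $\mu_1,\dots,\mu_k\in A^2$ satisfying both $$\sum_{i=1}^2 r_i\theta_{ij}=0\ \text{ for all } j\in\{1,\dots,k\},\qquad\text{and}\qquad f_i=\sum_{j=1}^k\theta_{ij}\mu_j\ \text{ for all } i\in\{1,2\}.$$
   Context: Let $\mathbb{D}=\{z\in\mathbb{C}:|z|<1\}$, and $\mathbb{N}=\{1,2,3,\dots\}$. $H^\infty$ is the algebra of bounded holomorphic functions on $\mathbb{D}$ with pointwise operations. The Bergman space $A^2$ is the set of all holomorphic $f:\mathbb{D}\to\mathbb{C}$ with $\|f\|_{A^2}^2:=\int_{\mathbb{D}}|f(z)|^2\,dA(z)<\infty$, where $dA$ is the area (Lebesgue) measure on $\mathbb{D}$. $A^2$ is an $H^\infty$-module under pointwise multiplication. *)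

(* Defs.v *)
From mathcomp Require Import all_boot all_order all_algebra complex.
From mathcomp Require Import all_classical all_reals all_analysis.

Set Implicit Arguments.
Unset Strict Implicit.
Unset Printing Implicit Defensive.

Import Order.TTheory GRing.Theory Num.Theory.
Import numFieldNormedType.Exports.
Import ComplexField.Normc.

Local Open Scope classical_set_scope.
Local Open Scope ring_scope.
Local Open Scope complex_scope.

(* A function on the disk is represented by a total function R[i] -> R[i]; its
   values outside the disk are irrelevant, so equality of functions means
   pointwise equality on unit_disk. The real-valued modulus is normc. *)

Definition unit_disk (R : realType) : set R[i] := [set z | normc z < 1].

(* The scalar field of the normed module R[i]^o is R[i], hence derivability in
   the direction 1 is the existence of the limit of (f (z + h) - f z) / h as the
   complex number h tends to 0. *)
Definition holomorphic_on_disk (R : realType) (f : R[i] -> R[i]) : Prop :=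
  forall z : R[i], unit_disk z -> derivable (f : R[i]^o -> R[i]^o) z 1.

Definition Hinfty (R : realType) : set (R[i] -> R[i]) :=
  [set f | holomorphic_on_disk f /\
     exists M : R, forall z : R[i], unit_disk z -> normc (f z) <= M].

(* Area measure is the product Lebesgue measure on R * R, the pair p standing for
   the complex number p.1 + i p.2. *)
Definition bergman_sqnorm (R : realType) (f : R[i] -> R[i]) : \bar R :=
  (\int[@lebesgue_measure R \x @lebesgue_measure R]_(p in
     [set p : R * R | unit_disk (p.1 +i* p.2)%C])
     (normc (f (p.1 +i* p.2)%C) ^+ 2)%:E)%E.

Definition bergman (R : realType) : set (R[i] -> R[i]) :=
  [set f | holomorphic_on_disk f /\ (bergman_sqnorm f < +oo)%E].

(* Main.v *)
Require Import Defs.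
From mathcomp Require Import all_boot all_order all_algebra complex.
From mathcomp Require Import all_classical all_reals all_analysis.
From mathcomp Require Import measurable_realfun ring lra.

(** Why the theorem holds.  Let S be the singular inner function
    exp (- (1 + z) / (1 - z)) and put r_0 = 1 - z, r_1 = - S, f_0 = S / (1 - z),
    f_1 = 1.  The pair (f_0, f_1) is the pair (- r_1, r_0) multiplied by the
    function 1 / (1 - z), and everything rests on two facts.

    First, 1 / (1 - z) is just not square integrable on the disk
    ([pole_not_bergman]: on each member of a sequence of disjoint squares that
    shrink to 1, the integral of its squared modulus is at least 1/5), whereas S is
    so small where z approaches 1 non-tangentially that S / (1 - z) is square
    integrable ([bergman_singular_pole]).

    Second, 1 - z and S have no common factor in H^oo: a relation
    r_0 theta_0 + r_1 theta_1 = 0 forces h = theta_1 / (1 - z) to be bounded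
    ([Hinfty_quotient]).  Indeed (1 - z) h = theta_1 and S h = theta_0 are both
    bounded.  On the region where Re ((1 + z) / (1 - z)) <= 1 the modulus of S is
    at least 1/e, so h is bounded there; the rest of the disk is a horodisk
    tangent to the circle at 1, on which h grows at most like 1 / |1 - z|, and the
    Phragmen-Lindelof argument of [phragmen_lindelof] carries the bound from the
    horocycle to the inside.

    Were f_i = \sum_j theta_ij mu_j, then dividing the equation for f_1 by 1 - z
    would give 1 / (1 - z) = \sum_j h_j mu_j with h_j bounded holomorphic and mu_j
    in A^2, hence 1 / (1 - z) in A^2, which is false.

    Boundedness of h uses the maximum modulus principle for functions that are
    merely complex differentiable at each point, so it is derived here from
    Goursat's theorem.  Bisection gives the vanishing of the integral of a
    holomorphic function along a rectangle ([goursat]).  Applied to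
    F (a + exp w) on a rectangle of height 2 pi, where the two horizontal sides
    cancel by periodicity, it says that the mean of F over a circle around a does
    not depend on the radius; hence Re F cannot be smaller by a fixed amount on a
    whole circle than it is at the centre ([circle_no_uniform_drop]).  At an
    interior maximum of Re (c F) + eta |z|^2 it would be so, and
    [maximum_modulus] follows. *)

Set Implicit Arguments.
Unset Strict Implicit.
Unset Printing Implicit Defensive.

Import Order.TTheory GRing.Theory Num.Theory.
Import numFieldNormedType.Exports.
Import ComplexField.Normc.

Local Open Scope classical_set_scope.
Local Open Scope ring_scope.
Local Open Scope complex_scope.

Local Notation Re := complex.Re.
Local Notation Im := complex.Im.

(** * The modulus and complex derivability *)

Lemma ge0_normc (R : realType) (z : R[i]) : 0 <= normc z.
Proof. by case: z => a b; exact: sqrtr_ge0. Qed.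

Lemma sqr_normc_def (R : realType) (z : R[i]) :
  normc z ^+ 2 = Re z ^+ 2 + Im z ^+ 2.
Proof. by case: z => a b /=; rewrite sqr_sqrtr// addr_ge0 ?sqr_ge0. Qed.

Lemma le_Re_normc (R : realType) (z : R[i]) : `|Re z| <= normc z.
Proof.
rewrite -(@ler_pXn2r _ 2)// ?nnegrE ?ge0_normc// sqr_normc_def -normrX.
by rewrite ger0_norm ?sqr_ge0// lerDl sqr_ge0.
Qed.

Lemma le_Im_normc (R : realType) (z : R[i]) : `|Im z| <= normc z.
Proof.
rewrite -(@ler_pXn2r _ 2)// ?nnegrE ?ge0_normc// sqr_normc_def -normrX.
by rewrite ger0_norm ?sqr_ge0// lerDr sqr_ge0.
Qed.

Lemma le_normc_ReIm (R : realType) (z : R[i]) : normc z <= `|Re z| + `|Im z|.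
Proof.
rewrite -(@ler_pXn2r _ 2)// ?nnegrE ?ge0_normc ?addr_ge0// sqr_normc_def.
have := normr_ge0 (Re z); have := normr_ge0 (Im z).
rewrite -(real_normK (num_real (Re z))) -(real_normK (num_real (Im z))).
by move: `|Re z| `|Im z| => a b; nra.
Qed.

Lemma ltc_normc (R : realType) (z : R[i]) (e : R) : (`|z| < e%:C) = (normc z < e).
Proof. by rewrite -ltcR. Qed.

(** Complex derivability in epsilon-delta form, with real tolerances: the form in
    which Goursat's bisection consumes it and in which it is easiest to establish
    for the exponential. *)
Lemma derivable_normcP (R : realType) (f : R[i] -> R[i]) (z : R[i]) :
  derivable (f : R[i]^o -> R[i]^o) z 1 <->
  exists l : R[i], forall e : R, 0 < e -> exists2 d : R, 0 < d &
    forall h, normc h < d -> normc (f (z + h) - f z - l * h) <= e * normc h.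
Proof.
split=> [/cvg_ex[D /cvgrPdist_le H]|[l hl]].
  exists D => e e0.
  have e0' : 0 < e%:C :> R[i] by rewrite ltcR.
  have := H _ e0'.
  rewrite /= /nbhs/= => -[d /= d0 Hd].
  have dE : d = (Re d)%:C.
    by move: d0; rewrite ltcE /=; case: (d) => a b /= /andP[/eqP-> _].
  have rd0 : 0 < Re d by move: d0; rewrite ltcE/= => /andP[].
  exists (Re d) => // h hd.
  have [->|h0] := eqVneq h 0.
    by rewrite addr0 subrr mulr0 subr0 normc0 mulr0.
  have := Hd h; rewrite /ball/= sub0r normrN => /(_ _ h0).
  rewrite dE ltc_normc => /(_ hd).
  rewrite /= lecR /GRing.scale/= => {}Hd.
  have -> : f (z + h) - f z - D * h =
     - (h * (D - h^-1 * (f (h * 1 + z) - f z))).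
    by rewrite mulr1 mulrBr mulrA mulfV// mul1r (mulrC h D) opprB (addrC z).
  rewrite normcN normcM mulrC.
  by rewrite ler_wpM2r// ge0_normc.
apply/cvg_ex; exists l; apply/cvgrPdist_le => e e0 /=.
have eE : e = (Re e)%:C.
  by move: e0; rewrite ltcE /=; case: (e) => a b /= /andP[/eqP-> _].
have re0 : 0 < Re e by move: e0; rewrite ltcE/= => /andP[].
have [d d0 Hd] := hl _ re0.
rewrite /nbhs/=; exists d%:C => /=; first by rewrite ltcR.
move=> h /=; rewrite sub0r normrN ltc_normc => hd h0.
rewrite eE lecR.
have -> : l - h^-1 *: (f (h *: 1 + z) - f z) = - (h^-1 * (f (z + h) - f z - l * h)).
  rewrite /GRing.scale/= mulr1 (addrC h) (mulrBr _ _ (l * h)) mulrCA mulVf//.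
  by rewrite mulr1 opprB.
rewrite normcN normcM normcV mulrC ler_pdivrMr; first exact: Hd.
rewrite lt_neqAle ge0_normc andbT eq_sym.
by apply: contra h0 => /eqP/eq0_normc ->.
Qed.

Lemma derivable_cts (R : realType) (f : R[i] -> R[i]) (z : R[i]) :
  derivable (f : R[i]^o -> R[i]^o) z 1 ->
  forall e : R, 0 < e -> exists2 d : R, 0 < d &
    forall h, normc h < d -> normc (f (z + h) - f z) <= e.
Proof.
move=> /derivable_normcP[l Hl] e e0; have [d d0 Hd] := Hl 1 ltr01.
have l1 : 0 < 1 + normc l by rewrite ltr_pwDl// ge0_normc.
exists (Num.min d (e / (1 + normc l))); first by rewrite lt_min d0 divr_gt0.
move=> h; rewrite lt_min => /andP[/Hd hd]; rewrite ltr_pdivlMr// => /ltW.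
apply: le_trans; rewrite -[f _ - _](subrK (l * h)).
apply: (le_trans (le_normcD _ _)); rewrite normcM.
by rewrite mulrDr mulr1 (mulrC (normc h)) lerD2r -[leRHS]mul1r.
Qed.

Lemma derivable_compC (R : realType) (f g : R[i] -> R[i]) (z : R[i]) :
  derivable (f : R[i]^o -> R[i]^o) z 1 ->
  derivable (g : R[i]^o -> R[i]^o) (f z) 1 ->
  derivable ((g \o f) : R[i]^o -> R[i]^o) z 1.
Proof.
move=> /derivable1_diffP df /derivable1_diffP dg.
by apply/derivable1_diffP; exact: (differentiable_comp df dg).
Qed.

Lemma derivable_mulC (R : realType) (f g : R[i] -> R[i]) (z : R[i]) :
  derivable (f : R[i]^o -> R[i]^o) z 1 ->
  derivable (g : R[i]^o -> R[i]^o) z 1 ->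
  derivable ((fun z => f z * g z) : R[i]^o -> R[i]^o) z 1.
Proof.
move=> df dg.
exact: (@derivableM R[i] R[i]^o f g z 1 df dg).
Qed.

Lemma derivable_scaleC (R : realType) (c : R[i]) (f : R[i] -> R[i]) (z : R[i]) :
  derivable (f : R[i]^o -> R[i]^o) z 1 ->
  derivable ((fun z => c * f z) : R[i]^o -> R[i]^o) z 1.
Proof.
move=> df; exact: (@derivableM R[i] R[i]^o (cst c) f z 1 (derivable_cst _ _ _) df).
Qed.

Lemma derivable_cst_sub (R : realType) (z : R[i]) (c : R[i]) :
  derivable ((fun z => c - z) : R[i]^o -> R[i]^o) z 1.
Proof.
exact: (@derivableB R[i] R[i]^o R[i]^o (cst c) id z 1 (derivable_cst _ _ _)
  (@derivable_id R[i] R[i]^o z 1)).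
Qed.

(** * The complex exponential *)

Definition cexp (R : realType) (z : R[i]) : R[i] :=
  (expR (Re z) * cos (Im z)) +i* (expR (Re z) * sin (Im z)).

Lemma cexpD (R : realType) (z w : R[i]) : cexp (z + w) = cexp z * cexp w.
Proof.
case: z => a b; case: w => c d; rewrite /cexp /=.
rewrite expRD cosD sinD; apply/eqP; rewrite eq_complex/=.
by apply/andP; split; apply/eqP; ring.
Qed.

Lemma normc_cexp (R : realType) (z : R[i]) : normc (cexp z) = expR (Re z).
Proof.
by rewrite /cexp /= !exprMn -mulrDr cos2Dsin2 mulr1 sqrtr_sqr gtr0_norm ?expR_gt0.
Qed.

Lemma is_derive_approx (R : realType) (f : R -> R) (x l : R) : is_derive x 1 f l ->
  forall e : R, 0 < e -> exists2 d : R, 0 < d &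
    forall h, `|h| < d -> `|f (x + h) - f x - l * h| <= e * `|h|.
Proof.
move=> [df <-] e e0.
have /cvgrPdist_le/(_ _ e0) := df; rewrite /nbhs/= => -[d /= d0 Hd].
exists d => // h hd; have [->|h0] := eqVneq h 0.
  by rewrite addr0 subrr mulr0 subr0 normr0 mulr0.
have := Hd h; rewrite /ball/= sub0r normrN => /(_ hd h0).
rewrite /derive; move: (lim _) => D; rewrite /GRing.scale/= => {}Hd.
have -> : f (x + h) - f x - D * h = - (h * (D - h^-1 * (f (h * 1 + x) - f x))).
  by rewrite mulr1 (addrC x); field.
by rewrite normrN normrM mulrC ler_wpM2r.
Qed.

(** The derivative of the exponential at 0; the addition formula then gives it
    everywhere.  The estimates for e^a, cos b and sin b near 0 are combined
    through e^a cos b - 1 - a = (e^a - 1 - a) + e^a (cos b - 1) and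
    e^a sin b - b = e^a (sin b - b) + (e^a - 1) b. *)
Lemma cexp_approx (R : realType) (e : R) : 0 < e -> exists2 d : R, 0 < d &
    forall h : R[i], normc h < d -> normc (cexp h - 1 - h) <= e * normc h.
Proof.
move=> e0.
(* Each of the two coordinates contributes 3 e2 |h|, and 6 / 8 <= 1. *)
pose e1 := e / 8.
pose e2 := Num.min e1 1.
have e10 : 0 < e1 by rewrite divr_gt0.
have e20 : 0 < e2 by rewrite lt_min e10 ltr01.
have e21 : e2 <= e1 by rewrite ge_min lexx.
have e2_1 : e2 <= 1 by rewrite ge_min lexx orbT.
have [d1 d10 H1] := is_derive_approx (is_derive_expR (0 : R)) e20.
have [d2 d20 H2] := is_derive_approx (is_derive_cos (0 : R)) e20.
have [d3 d30 H3] := is_derive_approx (is_derive_sin (0 : R)) e20.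
pose d := Num.min (Num.min d1 d2) (Num.min d3 (e2 / 2)).
exists d; first by rewrite !lt_min d10 d20 d30/= divr_gt0.
move=> [a b]; rewrite !lt_min => /andP[/andP[hd1 hd2] /andP[hd3 hd4]].
set h := a +i* b in hd1 hd2 hd3 hd4 *.
have ah : `|a| <= normc h := le_Re_normc h.
have bh : `|b| <= normc h := le_Im_normc h.
have := H1 a (le_lt_trans ah hd1).
have := H2 b (le_lt_trans bh hd2).
have := H3 b (le_lt_trans bh hd3).
rewrite !add0r expR0 cos0 sin0 !subr0 oppr0 !mul0r !mul1r !subr0.
move=> hs hc he.
have n0 := ge0_normc h.
apply: (le_trans (le_normc_ReIm _)); rewrite /cexp /=.
set E := expR a in he *; set C := cos b in hc *; set S := sin b in hs *.
have E0 : 0 < E by exact: expR_gt0.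
have aE : `|E - 1| <= 2 * normc h.
  have -> : E - 1 = (E - 1 - a) + a by ring.
  apply: (le_trans (ler_normD _ _)).
  have : e2 * `|a| <= 1 * normc h by apply: ler_pM => //; exact: ltW.
  lra.
have E2 : E <= 2.
  have := ler_norm (E - 1); have : normc h <= e2 / 2 by exact: ltW.
  lra.
have T1 : `|E * C - 1 - a| <= 3 * e2 * normc h.
  have -> : E * C - 1 - a = (E - 1 - a) + E * (C - 1) by ring.
  apply: (le_trans (ler_normD _ _)); rewrite normrM (gtr0_norm E0).
  have k1 : e2 * `|a| <= e2 * normc h by rewrite ler_pM2l.
  have k2 : E * `|C - 1| <= 2 * (e2 * normc h).
    apply: ler_pM => //; first exact: ltW.
    by apply: (le_trans hc); rewrite ler_pM2l.
  lra.
have T2 : `|E * S - 0 - b| <= 3 * e2 * normc h.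
  have -> : E * S - 0 - b = E * (S - b) + (E - 1) * b by ring.
  apply: (le_trans (ler_normD _ _)); rewrite !normrM (gtr0_norm E0).
  have k2 : E * `|S - b| <= 2 * (e2 * normc h).
    apply: ler_pM => //; first exact: ltW.
    by apply: (le_trans hs); rewrite ler_pM2l.
  have k3 : `|E - 1| * `|b| <= e2 * normc h.
    apply: ler_pM => //; apply: (le_trans aE).
    by move/ltW: hd4; rewrite ler_pdivlMr// mulrC.
  lra.
have : e2 * normc h <= e1 * normc h by apply: ler_wpM2r.
rewrite /e1; move: T1 T2; rewrite !oppr0 => T1 T2.
move=> T3; apply: (le_trans (lerD T1 T2)).
have en0 := mulr_ge0 (ltW e0) n0.
suff : 3 * e2 * normc h + 3 * e2 * normc h <= e * normc h by [].
lra.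
Qed.

Lemma derivable_cexp (R : realType) (z : R[i]) :
  derivable (@cexp R : R[i]^o -> R[i]^o) z 1.
Proof.
apply/derivable_normcP; exists (cexp z) => e e0.
have e0' : 0 < e / expR (Re z) by rewrite divr_gt0// expR_gt0.
have [d d0 Hd] := cexp_approx e0'.
exists d => // h /Hd.
have -> : cexp (z + h) - cexp z - cexp z * h = cexp z * (cexp h - 1 - h).
  by rewrite cexpD; ring.
rewrite normcM normc_cexp => H.
by rewrite mulrC -ler_pdivlMr ?expR_gt0// mulrAC.
Qed.

(** * Nested rectangles and integrals over segments *)

(** The bisection principle: a property that always passes from a w / 2^n by
    l / 2^n rectangle, named by its lower left corner, to one of its four quarters
    holds for arbitrarily small rectangles around some point p. *)
Lemma nested_quarters (R : realType) (w l : R) (P : nat -> R * R -> Prop) c0 :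
  0 <= w -> 0 <= l -> P 0%N c0 ->
  (forall n c, P n c -> exists a b : bool,
     P n.+1 (c.1 + a%:R * (w / 2 ^+ n.+1), c.2 + b%:R * (l / 2 ^+ n.+1))) ->
  exists p : R * R, forall n, exists c, [/\ P n c,
     c.1 <= p.1 <= c.1 + w / 2 ^+ n & c.2 <= p.2 <= c.2 + l / 2 ^+ n].
Proof.
move=> w0 l0 Pc0 step.
pose T := {s : nat * (R * R) | P s.1 s.2}.
pose next (s t : T) := (sval t).1 = (sval s).1.+1 /\
  exists a b : bool, (sval t).2 =
    ((sval s).2.1 + a%:R * (w / 2 ^+ (sval s).1.+1),
     (sval s).2.2 + b%:R * (l / 2 ^+ (sval s).1.+1)).
have nextP (s : T) : {t | next s t}.
  apply: cid; case: s => -[n c] /= Pc; have [a [b Pab]] := step _ _ Pc.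
  by exists (exist _ (n.+1, _) Pab); split => //; exists a, b.
have [u [u0 uS]] := dependent_choice nextP (exist _ (0%N, c0) Pc0).
have un n : (sval (u n)).1 = n.
  by elim: n => [|n IH]; [rewrite u0|rewrite (uS n).1 IH].
pose c n := (sval (u n)).2.
have Pc n : P n (c n) by rewrite -{1}(un n); exact: (svalP (u n)).
have cS n : exists a b : bool, c n.+1 =
    ((c n).1 + a%:R * (w / 2 ^+ n.+1), (c n).2 + b%:R * (l / 2 ^+ n.+1)).
  by have := (uS n).2; rewrite un.
have limit (x : nat -> R) (v : R) : 0 <= v ->
    (forall n, exists a : bool, x n.+1 = x n + a%:R * (v / 2 ^+ n.+1)) ->
    exists q, forall n, x n <= q <= x n + v / 2 ^+ n.
  move=> v0 xS.
  have half n : v / 2 ^+ n = v / 2 ^+ n.+1 + v / 2 ^+ n.+1.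
    by rewrite exprS; field.
  have xub n m : x (n + m)%N <= x n + (v / 2 ^+ n - v / 2 ^+ (n + m)).
    elim: m => [|m]; first by rewrite addn0 subrr addr0.
    rewrite addnS; have [a ->] := xS (n + m)%N.
    rewrite (half (n + m)%N); have : 0 <= v / 2 ^+ (n + m).+1.
      by rewrite divr_ge0// exprn_ge0.
    by case: a => /=; rewrite ?mul0r ?mul1r; lra.
  have xmono n m : x n <= x (n + m)%N.
    elim: m => [|m IH]; first by rewrite addn0.
    rewrite addnS; have [a ->] := xS (n + m)%N; apply: (le_trans IH).
    by rewrite lerDl mulr_ge0// divr_ge0// exprn_ge0.
  have ubx n : ubound (range x) (x n + v / 2 ^+ n).
    move=> _ [m _ <-]; have [nm|mn] := leqP n m.
      rewrite -(subnKC nm); apply: (le_trans (xub _ _)).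
      by rewrite lerD2l gerBl divr_ge0// exprn_ge0.
    have := xmono m (n - m)%N; rewrite subnKC ?(ltnW mn)// => /le_trans; apply.
    by rewrite lerDl divr_ge0// exprn_ge0.
  exists (sup (range x)) => n; apply/andP; split.
    by apply: ub_le_sup; [exists (x 0%N + v / 2 ^+ 0)|exists n].
  by apply: ge_sup; [exists (x 0%N), 0%N|exact: ubx].
have [p1 Hp1] : exists q, forall n, (c n).1 <= q <= (c n).1 + w / 2 ^+ n.
  by apply: limit => // n; have [a [b ->]] := cS n; exists a.
have [p2 Hp2] : exists q, forall n, (c n).2 <= q <= (c n).2 + l / 2 ^+ n.
  by apply: limit => // n; have [a [b ->]] := cS n; exists b.
by exists (p1, p2) => n; exists (c n).
Qed.

Lemma dist_segment (R : realType) (a b x y : R) :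
  a <= x <= b -> a <= y <= b -> `|x - y| <= b - a.
Proof.
by move=> /andP[? ?] /andP[? ?]; rewrite ler_norml; apply/andP; split; lra.
Qed.

Section segment_integral.
Variable R : realType.
Implicit Types (phi psi : R -> R) (a b c : R).
Local Notation mu := (@lebesgue_measure R).

Lemma integrable_segment phi a b :
  (forall x, a <= x <= b -> {for x, continuous phi}) ->
  mu.-integrable `[a, b] (EFin \o phi).
Proof.
move=> cphi; apply: continuous_compact_integrable; first exact: segment_compact.
apply: continuous_in_subspaceT => x; rewrite inE /= in_itv/=; exact: cphi.
Qed.

Lemma Rintegral_segment_split phi a b c : a <= b -> b <= c ->
  (forall x, a <= x <= c -> {for x, continuous phi}) ->
  \int[mu]_(x in `[a, c]) phi x =
  \int[mu]_(x in `[a, b]) phi x + \int[mu]_(x in `[b, c]) phi x.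
Proof.
move=> ab bc cphi; have ic := integrable_segment cphi.
rewrite -[LHS](subrK (\int[mu]_(x in `[a, b]) phi x)) Rintegral_itvB ?bnd_simp//.
rewrite addrC Rintegral_itv_obnd_cbnd//; apply: integrableS ic => //.
by move=> x /=; rewrite !in_itv/= => /andP[bx ->]; rewrite (le_trans ab (ltW bx)).
Qed.

Lemma Rintegral_segment_leD phi psi a b k : a <= b ->
  (forall x, a <= x <= b -> {for x, continuous phi}) ->
  (forall x, a <= x <= b -> {for x, continuous psi}) ->
  (forall x, a <= x <= b -> phi x + k <= psi x) ->
  \int[mu]_(x in `[a, b]) phi x + k * (b - a) <= \int[mu]_(x in `[a, b]) psi x.
Proof.
move=> ab /integrable_segment iphi /integrable_segment ipsi le_phi_psi.
have ik : mu.-integrable `[a, b] (EFin \o cst k).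
  by apply: integrable_segment => x _; exact: cvg_cst.
have length_ab : fine (mu `[a, b]) = b - a.
  rewrite lebesgue_measure_itv/= lte_fin.
  by case: ltgtP ab => //= -> _; rewrite subrr.
have -> : k * (b - a) = \int[mu]_(x in `[a, b]) (cst k x).
  by rewrite Rintegral_cst// length_ab.
rewrite -RintegralD//; apply: le_Rintegral => //.
by rewrite (_ : _ \o _ = (EFin \o phi) \+ (EFin \o cst k))%E//; exact: integrableD.
Qed.

(** This replaces the explicit integration of the affine part in the proof of
    Goursat's theorem: the integrals over two opposite sides are compared
    directly, through the increment k of the integrand from one to the other. *)
Lemma Rintegral_segment_dist phi psi a b k m : a <= b ->
  (forall x, a <= x <= b -> {for x, continuous phi}) ->
  (forall x, a <= x <= b -> {for x, continuous psi}) ->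
  (forall x, a <= x <= b -> `|phi x - psi x - k| <= m) ->
  `|\int[mu]_(x in `[a, b]) phi x - \int[mu]_(x in `[a, b]) psi x - k * (b - a)|
     <= m * (b - a).
Proof.
move=> ab cphi cpsi dist.
have lo : \int[mu]_(x in `[a, b]) psi x + (k - m) * (b - a) <=
          \int[mu]_(x in `[a, b]) phi x.
  apply: Rintegral_segment_leD => // x /dist.
  by rewrite ler_norml => /andP[? _]; lra.
have up : \int[mu]_(x in `[a, b]) phi x + - (k + m) * (b - a) <=
          \int[mu]_(x in `[a, b]) psi x.
  apply: Rintegral_segment_leD => // x /dist.
  by rewrite ler_norml => /andP[_ ?]; lra.
by rewrite ler_norml; apply/andP; split; lra.
Qed.
End segment_integral.

(** * Goursat's theorem on rectangles *)

Section goursat.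
Variable R : realType.
Variable g : R[i] -> R[i].
Local Notation mu := (@lebesgue_measure R).

Lemma continuous_Re_vertical x y : derivable (g : R[i]^o -> R[i]^o) (x +i* y) 1 ->
  {for y, continuous (fun t => Re (g (x +i* t)))}.
Proof.
move=> /derivable_cts dg; apply/cvgrPdist_le => e /dg[d d0 Hd].
exists d => // t /=; rewrite distrC => yt.
have := Hd (0 +i* (t - y)); rewrite distrC.
have -> : x +i* y + 0 +i* (t - y) = x +i* t.
  by apply/eqP; rewrite eq_complex/= addr0 addrC subrK !eqxx.
have -> : normc (0 +i* (t - y)) = `|t - y| by rewrite /= expr0n add0r sqrtr_sqr.
move=> /(_ yt); apply: le_trans.
by rewrite (le_trans _ (le_Re_normc _))//; case: (g _) (g _) => ? ? [].
Qed.

Lemma continuous_Im_horizontal x y : derivable (g : R[i]^o -> R[i]^o) (x +i* y) 1 ->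
  {for x, continuous (fun t => Im (g (t +i* y)))}.
Proof.
move=> /derivable_cts dg; apply/cvgrPdist_le => e /dg[d d0 Hd].
exists d => // t /=; rewrite distrC => xt.
have := Hd ((t - x) +i* 0); rewrite distrC.
have -> : x +i* y + (t - x) +i* 0 = t +i* y.
  by apply/eqP; rewrite eq_complex/= addr0 addrC subrK !eqxx.
have -> : normc ((t - x) +i* 0) = `|t - x| by rewrite /= expr0n addr0 sqrtr_sqr.
move=> /(_ xt); apply: le_trans.
by rewrite (le_trans _ (le_Im_normc _))//; case: (g _) (g _) => ? ? [].
Qed.

Definition vertical_int x y0 y1 : R := \int[mu]_(y in `[y0, y1]) Re (g (x +i* y)).
Definition horizontal_int y x0 x1 : R := \int[mu]_(x in `[x0, x1]) Im (g (x +i* y)).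
(** The imaginary part of the integral of g dz along the positively oriented
    boundary, that is, the integral of the form Re g dy + Im g dx.  Its
    vertical sides carry the mean values of Re g. *)
Definition rect_int x0 x1 y0 y1 : R :=
  vertical_int x1 y0 y1 - vertical_int x0 y0 y1
  - (horizontal_int y1 x0 x1 - horizontal_int y0 x0 x1).

Definition derivable_on_rect x0 x1 y0 y1 := forall x y : R,
  x0 <= x <= x1 -> y0 <= y <= y1 -> derivable (g : R[i]^o -> R[i]^o) (x +i* y) 1.

Lemma rect_int_split x0 xm x1 y0 ym y1 :
  x0 <= xm -> xm <= x1 -> y0 <= ym -> ym <= y1 -> derivable_on_rect x0 x1 y0 y1 ->
  rect_int x0 x1 y0 y1 = rect_int x0 xm y0 ym + rect_int xm x1 y0 ym
    + (rect_int x0 xm ym y1 + rect_int xm x1 ym y1).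
Proof.
move=> x0m xm1 y0m ym1 dg.
have V x : x0 <= x <= x1 -> vertical_int x y0 y1 =
    vertical_int x y0 ym + vertical_int x ym y1.
  move=> xx; apply: Rintegral_segment_split => // y yy.
  by apply: continuous_Re_vertical; exact: dg.
have H y : y0 <= y <= y1 -> horizontal_int y x0 x1 =
    horizontal_int y x0 xm + horizontal_int y xm x1.
  move=> yy; apply: Rintegral_segment_split => // x xx.
  by apply: continuous_Im_horizontal; exact: dg.
have x01 := le_trans x0m xm1; have y01 := le_trans y0m ym1.
rewrite /rect_int !V ?H ?lexx ?x01 ?y01//; ring.
Qed.

(** Near a point where g is approximated by its tangent with error e |z - p|, the
    boundary integral is of order e times the square of the size.  The linear part
    drops out by the Cauchy-Riemann equations: Re l is the rate at which Re g grows
    horizontally and also the rate at which Im g grows vertically. *)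
Lemma rect_int_small x0 x1 y0 y1 (p l : R[i]) e :
  x0 <= x1 -> y0 <= y1 -> x0 <= Re p <= x1 -> y0 <= Im p <= y1 -> 0 <= e ->
  derivable_on_rect x0 x1 y0 y1 ->
  (forall x y, x0 <= x <= x1 -> y0 <= y <= y1 ->
     normc (g (x +i* y) - g p - l * (x +i* y - p)) <= e * normc (x +i* y - p)) ->
  `|rect_int x0 x1 y0 y1| <= 2 * e * ((x1 - x0) + (y1 - y0)) ^+ 2.
Proof.
move=> x01 y01 px py e0 dg Hg; set s := (x1 - x0) + (y1 - y0).
have err x y : x0 <= x <= x1 -> y0 <= y <= y1 ->
    normc (g (x +i* y) - g p - l * (x +i* y - p)) <= e * s.
  move=> xx yy; apply: (le_trans (Hg _ _ xx yy)); apply: ler_wpM2l => //.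
  apply: (le_trans (le_normc_ReIm _)); rewrite /s.
  by case: (p) px py => p1 p2 /= px py; rewrite lerD// (dist_segment xx, dist_segment yy).
have x00 : x0 <= x0 <= x1 by rewrite lexx.
have x11 : x0 <= x1 <= x1 by rewrite lexx andbT.
have y00 : y0 <= y0 <= y1 by rewrite lexx.
have y11 : y0 <= y1 <= y1 by rewrite lexx andbT.
have V : `|vertical_int x1 y0 y1 - vertical_int x0 y0 y1
    - (Re l * (x1 - x0)) * (y1 - y0)| <= (2 * (e * s)) * (y1 - y0).
  apply: Rintegral_segment_dist => //.
  - by move=> y yy; apply: continuous_Re_vertical; exact: dg.
  - by move=> y yy; apply: continuous_Re_vertical; exact: dg.
  move=> y yy; have := le_trans (le_Re_normc _) (err _ _ x11 yy).
  have := le_trans (le_Re_normc _) (err _ _ x00 yy).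
  case: (g (x1 +i* y)) => a1 b1; case: (g (x0 +i* y)) => a2 b2.
  case: (g p) => a b; case: (p) => p1 p2; case: (l) => l1 l2 /=.
  by rewrite !ler_norml => /andP[? ?] /andP[? ?]; apply/andP; split; lra.
have H : `|horizontal_int y1 x0 x1 - horizontal_int y0 x0 x1
    - (Re l * (y1 - y0)) * (x1 - x0)| <= (2 * (e * s)) * (x1 - x0).
  apply: Rintegral_segment_dist => //.
  - by move=> x xx; apply: continuous_Im_horizontal; exact: dg.
  - by move=> x xx; apply: continuous_Im_horizontal; exact: dg.
  move=> x xx; have := le_trans (le_Im_normc _) (err _ _ xx y11).
  have := le_trans (le_Im_normc _) (err _ _ xx y00).
  case: (g (x +i* y1)) => a1 b1; case: (g (x +i* y0)) => a2 b2.
  case: (g p) => a b; case: (p) => p1 p2; case: (l) => l1 l2 /=.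
  by rewrite !ler_norml => /andP[? ?] /andP[? ?]; apply/andP; split; lra.
have -> : 2 * e * s ^+ 2 = 2 * (e * s) * (y1 - y0) + 2 * (e * s) * (x1 - x0).
  by rewrite /s; ring.
move: V H; rewrite /rect_int !ler_norml => /andP[? ?] /andP[? ?].
by apply/andP; split; lra.
Qed.

(** If the integral were J <> 0, suitable successive quarters would keep an integral
    of at least |J| / 4^n; but near the point to which they shrink,
    [rect_int_small] bounds it by 2 e s^2 / 4^n, where s is the half perimeter of the
    rectangle and e is as small as desired. *)
Lemma goursat x0 x1 y0 y1 : x0 <= x1 -> y0 <= y1 ->
  derivable_on_rect x0 x1 y0 y1 -> rect_int x0 x1 y0 y1 = 0.
Proof.
move=> x01 y01 dg; apply: contrapT => /eqP J0.
set J := rect_int x0 x1 y0 y1 in J0 *.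
pose w := x1 - x0; pose l := y1 - y0.
have w0 : 0 <= w by rewrite subr_ge0.
have l0 : 0 <= l by rewrite subr_ge0.
have aJ : 0 < `|J| by rewrite normr_gt0.
pose P n (c : R * R) := [/\ `|J| / 4 ^+ n <=
    `|rect_int c.1 (c.1 + w / 2 ^+ n) c.2 (c.2 + l / 2 ^+ n)|,
  x0 <= c.1, c.1 + w / 2 ^+ n <= x1, y0 <= c.2 & c.2 + l / 2 ^+ n <= y1].
have half (v : R) n : v / 2 ^+ n = v / 2 ^+ n.+1 + v / 2 ^+ n.+1.
  by rewrite exprS; field.
have pos (v : R) n : 0 <= v -> 0 <= v / 2 ^+ n.
  by move=> v0; rewrite divr_ge0// exprn_ge0.
have sub c n : P n c -> derivable_on_rect c.1 (c.1 + w / 2 ^+ n) c.2 (c.2 + l / 2 ^+ n).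
  move=> [_ ? ? ? ?] x y /andP[? ?] /andP[? ?]; apply: dg; apply/andP; split; lra.
have P0 : P 0%N (x0, y0).
  by rewrite /P /= !expr0 !divr1 /w /l !(addrC _ (_ - _)) !subrK.
have [n [a b] Pc|p Hp] := nested_quarters w0 l0 P0.
  have [HJ c1 c2 c3 c4] := Pc; rewrite /= in HJ c1 c2 c3 c4.
  have := sub _ _ Pc; rewrite /= => dc.
  have wn := pos _ n.+1 w0; have ln := pos _ n.+1 l0.
  have := half w n; have := half l n.
  move: HJ c2 c4 dc wn ln.
  set w' := w / 2 ^+ n; set w'' := w / 2 ^+ n.+1.
  set l' := l / 2 ^+ n; set l'' := l / 2 ^+ n.+1.
  move=> HJ c2 c4 dc wn ln lE wE.
  have h1 : a <= a + w'' by lra.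
  have h2 : a + w'' <= a + w' by lra.
  have h3 : b <= b + l'' by lra.
  have h4 : b + l'' <= b + l' by lra.
  have := rect_int_split h1 h2 h3 h4 dc.
  set A := rect_int _ _ _ _ in HJ *; set A1 := rect_int _ _ _ _.
  set A2 := rect_int _ _ _ _; set A3 := rect_int _ _ _ _.
  set A4 := rect_int _ _ _ _ => AE.
  have E4 : `|J| / 4 ^+ n = 4 * (`|J| / 4 ^+ n.+1) by rewrite exprS; field.
  have : exists i j : bool, `|J| / 4 ^+ n.+1 <=
    `|rect_int (a + i%:R * w'') (a + i%:R * w'' + w'')
               (b + j%:R * l'') (b + j%:R * l'' + l'')|.
    apply: contrapT => /forallNP NE.
    have F (i j : bool) : `|rect_int (a + i%:R * w'') (a + i%:R * w'' + w'')
               (b + j%:R * l'') (b + j%:R * l'' + l'')| < `|J| / 4 ^+ n.+1.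
      by rewrite ltNge; apply/negP => K; exact: (NE i (ex_intro _ j K)).
    have := F true true; have := F true false; have := F false true.
    have := F false false; rewrite !mul0r !mul1r !addr0.
    have -> : a + w'' + w'' = a + w' by rewrite wE addrA.
    have -> : b + l'' + l'' = b + l' by rewrite lE addrA.
    rewrite -/A1 -/A2 -/A3 -/A4 => F1 F2 F3 F4.
    have : `|A| <= `|A1| + `|A2| + (`|A3| + `|A4|).
      rewrite AE; apply: (le_trans (ler_normD _ _)).
      by apply: lerD; exact: ler_normD.
    by move: HJ F1 F2 F3 F4; rewrite E4; clear; lra.
  move=> [i [j Hij]]; exists i, j; split => //=; rewrite -/w'' -/l''.
  - by case: (i) => /=; rewrite ?mul1r ?mul0r; lra.
  - by case: (i) => /=; rewrite ?mul1r ?mul0r; lra.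
  - by case: (j) => /=; rewrite ?mul1r ?mul0r; lra.
  - by case: (j) => /=; rewrite ?mul1r ?mul0r; lra.
have [c0 []] := Hp 0%N; rewrite !expr0 !divr1.
move=> -[_ a1 a2 a3 a4] /andP[a5 a6] /andP[a7 a8].
rewrite !expr0 !divr1 in a2 a4.
have dp : derivable (g : R[i]^o -> R[i]^o) (p.1 +i* p.2) 1.
  by apply: dg; apply/andP; split; lra.
pose s := w + l; have s0 : 0 <= s by rewrite addr_ge0.
(* Small enough for 2 e s^2 < |J|; the summand 1 covers s = 0. *)
pose e := `|J| / (4 * (s ^+ 2 + 1)).
have s2 : 0 < 4 * (s ^+ 2 + 1) by rewrite mulr_gt0// ltr_pwDr// sqr_ge0.
have e0 : 0 < e by rewrite divr_gt0.
have /derivable_normcP[D HD] := dp.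
have [d d0 Hd] := HD _ e0.
pose n := Num.bound (s / d).
have sn : s / 2 ^+ n < d.
  rewrite ltr_pdivrMr ?exprn_gt0// mulrC -ltr_pdivrMr//.
  apply: (lt_trans (archi_boundP _)); first by rewrite divr_ge0// ltW.
  by rewrite -natrX ltr_nat ltn_expl.
have [c [Pc /andP[p1 p2] /andP[p3 p4]]] := Hp n.
have snE : s / 2 ^+ n = w / 2 ^+ n + l / 2 ^+ n by rewrite /s mulrDl.
have := @rect_int_small c.1 (c.1 + w / 2 ^+ n) c.2 (c.2 + l / 2 ^+ n) (p.1 +i* p.2) D e.
have -> : (c.1 + w / 2 ^+ n - c.1 + (c.2 + l / 2 ^+ n - c.2)) = s / 2 ^+ n.
  by rewrite snE; ring.
rewrite !lerDl !pos// p1 p2 p3 p4 => /(_ isT isT isT isT (ltW e0) (sub _ _ Pc)).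
have near x y : c.1 <= x <= c.1 + w / 2 ^+ n -> c.2 <= y <= c.2 + l / 2 ^+ n ->
    normc (g (x +i* y) - g (p.1 +i* p.2) - D * (x +i* y - (p.1 +i* p.2))) <=
      e * normc (x +i* y - (p.1 +i* p.2)).
  move=> xx yy; have := Hd (x +i* y - p.1 +i* p.2).
  rewrite [p.1 +i* p.2 + _]addrC subrK; apply.
  apply: le_lt_trans sn; apply: (le_trans (le_normc_ReIm _)) => /=.
  have wn : w / 2 ^+ n = c.1 + w / 2 ^+ n - c.1 by rewrite addrC addKr.
  have ln : l / 2 ^+ n = c.2 + l / 2 ^+ n - c.2 by rewrite addrC addKr.
  rewrite snE wn ln; apply: lerD.
    by apply: dist_segment => //; apply/andP.
  by apply: dist_segment => //; apply/andP.
move=> /(_ near).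
have [+ _ _ _ _] := Pc => /le_trans/[apply].
have -> : 2 * e * (s / 2 ^+ n) ^+ 2 = (2 * e * s ^+ 2) / 4 ^+ n.
  have four : (2 ^+ n) ^+ 2 = 4 ^+ n :> R by rewrite -exprM mulnC exprM -natrX.
  by rewrite expr_div_n four mulrA.
rewrite ler_pM2r ?invr_gt0 ?exprn_gt0// => le1.
have : e * (4 * (s ^+ 2 + 1)) = `|J| by rewrite /e divfK// gt_eqF.
have := mulr_ge0 (ltW e0) (sqr_ge0 s).
by move: le1; lra.
Qed.

End goursat.

(** * Mean values on circles and the maximum modulus principle *)

(** A one-sided form of the mean value property.  In the coordinate w with
    z = a + exp w, circles around a are vertical segments of length 2 pi, and
    [goursat] equates the integrals of Re F over two of them; on a small enough
    circle Re F exceeds Re (F a) - d / 2. *)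
Lemma circle_no_uniform_drop (R : realType) (F : R[i] -> R[i]) (a : R[i]) (r d : R) :
  0 < r -> 0 < d ->
  (forall z, normc (z - a) <= r -> derivable (F : R[i]^o -> R[i]^o) z 1) ->
  ~ (forall z, normc (z - a) = r -> Re (F z) <= Re (F a) - d).
Proof.
move=> r0 d0 dF drop.
pose g w := F (a + cexp w).
pose s1 := ln r.
have es1 : expR s1 = r by rewrite lnK.
have dg w : Re w <= s1 -> derivable (g : R[i]^o -> R[i]^o) w 1.
  move=> ws; apply: (@derivable_compC _ (fun w => a + cexp w) F).
    by apply: derivableD; [exact: derivable_cst|exact: derivable_cexp].
  by apply: dF; rewrite addrC addKr normc_cexp -es1 ler_expR.
have /derivable_cts/(_ (d / 2)) : derivable (F : R[i]^o -> R[i]^o) a 1.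
  by apply: dF; rewrite subrr normc0 ltW.
rewrite divr_gt0// => /(_ isT)[rho rho0 near_a].
pose s0 := Num.min s1 (ln (rho / 2)).
have s01 : s0 <= s1 by rewrite ge_min lexx.
have es0 : expR s0 < rho.
  apply: (@le_lt_trans _ _ (rho / 2)); last by lra.
  by rewrite -[leRHS]lnK ?posrE ?divr_gt0// ler_expR ge_min lexx orbT.
have pi2 : 0 <= pi *+ 2 :> R by rewrite mulrn_wge0// pi_ge0.
have := @goursat R g s0 s1 0 (pi *+ 2) s01 pi2.
rewrite /rect_int.
have -> : horizontal_int g (pi *+ 2) s0 s1 = horizontal_int g 0 s0 s1.
  rewrite /horizontal_int; apply: eq_Rintegral => x _; rewrite /g /cexp/=.
  by rewrite cos2pi sin2pi cos0 sin0.
rewrite (subrr (horizontal_int g 0 s0 s1)) subr0 => J0.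
have {}J0 : vertical_int g s1 0 (pi *+ 2) - vertical_int g s0 0 (pi *+ 2) = 0.
  by apply: J0 => x y /andP[_ xs] _; exact: dg.
have drop_int : vertical_int g s1 0 (pi *+ 2) + (d / 2) * (pi *+ 2 - 0) <=
       vertical_int g s0 0 (pi *+ 2).
  apply: Rintegral_segment_leD => //.
  - by move=> y _; apply: continuous_Re_vertical; exact: dg.
  - by move=> y _; apply: continuous_Re_vertical; exact: dg.
  move=> y _.
  have : Re (g (s1 +i* y)) <= Re (F a) - d.
    by apply: drop; rewrite addrC addKr normc_cexp.
  have := near_a (cexp (s0 +i* y)); rewrite normc_cexp => /(_ es0).
  move/(le_trans (le_Re_normc _)); rewrite /g.
  case: (F (a + cexp (s0 +i* y))) => p1 p2; case: (F a) => q1 q2 /=.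
  rewrite ler_norml => /andP[lo _] up.
  by move: lo up; move: (Re _) => v1; clear; lra.
move: (mulr_gt0 d0 (pi_gt0 R)) drop_int J0.
move: (vertical_int g s1 _ _) (vertical_int g s0 _ _) => V1 V0.
by rewrite (mulr2n pi); clear; lra.
Qed.

Lemma near_pair_dist (R : realType) (p : R * R) (d : R) : 0 < d ->
  \forall t \near p, `|p.1 - t.1| < d /\ `|p.2 - t.2| < d.
Proof.
move=> d0; apply: filterI.
  exact: (cvgrPdist_lt _ _).1 (@cvg_fst _ _ (nbhs p.1) (nbhs p.2) _) _ d0.
exact: (cvgrPdist_lt _ _).1 (@cvg_snd _ _ (nbhs p.1) (nbhs p.2) _) _ d0.
Qed.

(** The area measure and the compactness arguments live on R * R, so
    continuity is transferred there coordinatewise. *)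
Lemma continuous_ReIm_pair (R : realType) (F : R[i] -> R[i]) (p : R * R) :
  derivable (F : R[i]^o -> R[i]^o) (p.1 +i* p.2) 1 ->
  {for p, continuous (fun t : R * R => Re (F (t.1 +i* t.2)))} /\
  {for p, continuous (fun t : R * R => Im (F (t.1 +i* t.2)))}.
Proof.
move=> /derivable_cts dF.
have main (e : R) : 0 < e -> \forall t \near p,
    normc (F (t.1 +i* t.2) - F (p.1 +i* p.2)) <= e.
  move=> /dF[d d0 Hd].
  have d2 : 0 < d / 2 by rewrite divr_gt0.
  apply: filterS (near_pair_dist p d2) => t [t1 t2].
  have := Hd (t.1 +i* t.2 - p.1 +i* p.2).
  rewrite [p.1 +i* p.2 + _]addrC subrK; apply.
  apply: (le_lt_trans (le_normc_ReIm _)) => /=.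
  rewrite (distrC t.1) (distrC t.2); lra.
by split; apply/cvgrPdist_le => e /main; apply: filterS => t;
  apply: le_trans; rewrite distrC;
  [apply: (le_trans _ (le_Re_normc _))|apply: (le_trans _ (le_Im_normc _))];
  case: (F _) (F _) => ? ? [].
Qed.

(** The points of K where the bound is not assumed only have to be interior to K,
    so the shape of the boundary never matters.  With c the conjugate of a value of
    F of modulus above B, maximise phi = Re (c F) + eta |z|^2 over K.  For small eta the
    maximum point a is interior, and the holomorphic function
    G = c F + 2 eta (conj a) z satisfies Re G = phi - eta |z - a|^2 + eta |a|^2, hence
    drops by at least eta r^2 on the circle of radius r around a. *)
Lemma maximum_modulus (R : realType) (K : set (R * R)) (F : R[i] -> R[i]) (B : R) :
  compact K -> 0 <= B ->
  (forall p, K p -> derivable (F : R[i]^o -> R[i]^o) (p.1 +i* p.2) 1) ->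
  (forall p, K p -> normc (F (p.1 +i* p.2)) <= B \/
     exists2 r, 0 < r & forall z, normc (z - p.1 +i* p.2) <= r -> K (Re z, Im z)) ->
  forall p, K p -> normc (F (p.1 +i* p.2)) <= B.
Proof.
move=> cK B0 dF bd p0 Kp0; rewrite leNgt; apply/negP => Bp0.
have K0 : K !=set0 by exists p0.
have csq : {within K, continuous (fun p : R * R => p.1 ^+ 2 + p.2 ^+ 2)}.
  apply: continuous_in_subspaceT => p _.
  by apply: cvgD; apply: cvgM; (exact: cvg_fst || exact: cvg_snd).
have [q _ Hq] := compact_EVT_max K0 cK csq.
set L := q.1 ^+ 2 + q.2 ^+ 2 in Hq.
have L0 : 0 <= L by rewrite addr_ge0 ?sqr_ge0.
have KL p : K p -> p.1 ^+ 2 + p.2 ^+ 2 <= L by move=> Kp; apply: Hq; rewrite inE.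
set c := F (p0.1 +i* p0.2) in Bp0; set m := normc c in Bp0.
have m0 : 0 < m by exact: le_lt_trans Bp0.
(* L bounds |z|^2 on K, so the perturbation costs less than m (m - B). *)
pose eta := m * (m - B) / (2 * (L + 1)).
have eta0 : 0 < eta by rewrite divr_gt0// mulr_gt0//; lra.
have etaL : m * B + eta * L < m ^+ 2.
  have : eta * (2 * (L + 1)) = m * (m - B) by rewrite /eta divfK// gt_eqF//; lra.
  have := mulr_ge0 (ltW eta0) L0; lra.
pose phi (p : R * R) := Re (c^*%C * F (p.1 +i* p.2)) + eta * (p.1 ^+ 2 + p.2 ^+ 2).
have dcF z : derivable (F : R[i]^o -> R[i]^o) z 1 ->
    derivable ((fun z => c^*%C * F z) : R[i]^o -> R[i]^o) z 1.
  by move=> dFz; exact: derivable_scaleC.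
have cphi : {within K, continuous phi}.
  apply: continuous_in_subspaceT => p; rewrite inE => /dF/dcF dFp.
  apply: cvgD; first exact: (continuous_ReIm_pair dFp).1.
  apply: cvgM; first exact: cvg_cst.
  by apply: cvgD; apply: cvgM; (exact: cvg_fst || exact: cvg_snd).
have [a + Ha] := compact_EVT_max K0 cK cphi; rewrite inE => Ka.
have le_a p : K p -> phi p <= phi a by move=> Kp; apply: Ha; rewrite inE.
have phi0 : m ^+ 2 <= phi p0.
  rewrite /phi -/c; have -> : Re (c^*%C * c) = m ^+ 2.
    by rewrite sqr_normc_def; case: (c) => x y /=; ring.
  by rewrite lerDl mulr_ge0 ?(ltW eta0)// addr_ge0 ?sqr_ge0.
have [Fa|[r r0 Kr]] := bd _ Ka.
  have : phi a <= m * B + eta * L.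
    apply: lerD; last by rewrite ler_wpM2l ?(ltW eta0)// KL.
    apply: (le_trans (ler_norm _)); apply: (le_trans (le_Re_normc _)).
    rewrite normcM; apply: ler_pM => //; rewrite ?ge0_normc//.
    by rewrite /m; case: (c) => x y /=; rewrite sqrrN.
  by have := le_a _ Kp0; lra.
pose A := a.1 +i* a.2.
pose G z := c^*%C * F z + (2 * eta)%:C * A^*%C * z.
have GE z : Re (G z) = phi (Re z, Im z) + eta * (Re A ^+ 2 + Im A ^+ 2)
    - eta * normc (z - A) ^+ 2.
  rewrite sqr_normc_def /G /phi /=; case: z => x y /=.
  by case: (F _) => ? ?; case: (c) => ? ? /=; ring.
apply: (@circle_no_uniform_drop R G A r (eta * r ^+ 2) r0).
- by rewrite mulr_gt0// exprn_gt0.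
- move=> z /Kr/dF; case: z => x y /= /dcF dFz.
  have dz := @derivable_scaleC R ((2 * eta)%:C * A^*%C) id (x +i* y)
    (@derivable_id R[i] R[i]^o (x +i* y) 1).
  exact: (derivableD dFz dz).
- move=> z zr; rewrite !GE zr subrr normc0 expr0n mulr0 subr0 /=.
  have : phi (Re z, Im z) <= phi a by apply: le_a; apply: Kr; rewrite -/A zr.
  by rewrite -surjective_pairing; lra.
Qed.

(** * The singular inner function and division by it *)

(** The conformal map of the disk onto the right half-plane that sends 1 to
    infinity. *)
Definition cayley (R : realType) (z : R[i]) : R[i] := (1 + z) / (1 - z).

(** The inner function whose singular measure is a point mass at 1. *)
Definition singular_inner (R : realType) (z : R[i]) : R[i] := cexp (- cayley z).

Lemma Re_lt1_disk (R : realType) (z : R[i]) : unit_disk z -> Re z < 1.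
Proof. by apply: le_lt_trans; apply: le_trans (le_Re_normc z); exact: ler_norm. Qed.

Lemma sub1_neq0_disk (R : realType) (z : R[i]) : unit_disk z -> 1 - z != 0.
Proof.
move=> /Re_lt1_disk z1; apply/negP => /eqP/(congr1 (@complex.Re R)).
by case: z z1 => a b /= ? /eqP; rewrite subr_eq0 => /eqP E; lra.
Qed.

Lemma normc_sub1_gt0 (R : realType) (z : R[i]) : unit_disk z -> 0 < normc (1 - z).
Proof.
move=> /sub1_neq0_disk z1; rewrite lt_neqAle ge0_normc andbT eq_sym.
by apply: contra z1 => /eqP/eq0_normc ->.
Qed.

Lemma Re_cayley (R : realType) (z : R[i]) : unit_disk z ->
  Re (cayley z) = (1 - normc z ^+ 2) / normc (1 - z) ^+ 2.
Proof.
move=> /normc_sub1_gt0 z1.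
have : 0 < normc (1 - z) ^+ 2 by rewrite exprn_gt0.
rewrite !sqr_normc_def /cayley; case: z {z1} => x y /= z1.
by field; rewrite gt_eqF//; move: z1; rewrite sub0r sqrrN.
Qed.

Lemma normc_singular_inner (R : realType) (z : R[i]) : unit_disk z ->
  normc (singular_inner z) = expR (- ((1 - normc z ^+ 2) / normc (1 - z) ^+ 2)).
Proof.
move=> z1; rewrite /singular_inner normc_cexp -Re_cayley//.
by case: (cayley z).
Qed.

Lemma holomorphic_singular_inner (R : realType) :
  holomorphic_on_disk (@singular_inner R).
Proof.
move=> z z1; apply: (@derivable_compC _ (fun z => - cayley z) (@cexp R)).
  apply: (@derivableN R[i] R[i]^o R[i]^o (@cayley R)).
  apply: (@derivable_mulC _ (fun z => 1 + z) (fun z => (1 - z)^-1)).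
    exact: (@derivableD R[i] R[i]^o R[i]^o (cst 1) id z 1 (derivable_cst _ _ _)
      (@derivable_id R[i] R[i]^o z 1)).
  apply: (@derivableV R[i] R[i]^o (fun z => 1 - z)); first exact: sub1_neq0_disk.
  exact: derivable_cst_sub.
exact: derivable_cexp.
Qed.

Lemma normc_dist (R : realType) (z w : R[i]) : `|normc z - normc w| <= normc (z - w).
Proof.
rewrite ler_norml; apply/andP; split.
  have := le_normcD (w - z) z; rewrite subrK -(normcN (w - z)) opprB; lra.
have := le_normcD (z - w) w; rewrite subrK; lra.
Qed.

Lemma continuous_normc_pair (R : realType) (c : R[i]) :
  continuous (fun t : R * R => normc (t.1 +i* t.2 - c)).
Proof.
move=> p; apply/cvgrPdist_le => e e0.
have e2 : 0 < e / 2 by rewrite divr_gt0.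
apply: filterS (near_pair_dist p e2) => t [t1 t2].
apply: (le_trans (normc_dist _ _)).
rewrite opprB addrA subrK; apply: (le_trans (le_normc_ReIm _)) => /=; lra.
Qed.

Lemma compact_disk_minus_disk (R : realType) (c a : R[i]) (s rho : R) :
  compact [set p : R * R | normc (p.1 +i* p.2 - c) <= s /\
                           rho <= normc (p.1 +i* p.2 - a)].
Proof.
have cB : compact (`[Re c - s, Re c + s] `*` `[Im c - s, Im c + s] : set (R * R)).
  by apply: compact_setX; exact: segment_compact.
apply: (subclosed_compact _ cB).
  apply: (@closedI _ [set p : R * R | normc (p.1 +i* p.2 - c) <= s]
                     [set p : R * R | rho <= normc (p.1 +i* p.2 - a)]).
    apply: (@preimage_closed _ _ (fun p : R * R => normc (p.1 +i* p.2 - c)) [set x | x <= s]).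
      by move=> p _; exact: continuous_normc_pair.
    exact: closed_le.
  apply: (@preimage_closed _ _ (fun p : R * R => normc (p.1 +i* p.2 - a)) [set x | rho <= x]).
    by move=> p _; exact: continuous_normc_pair.
  exact: closed_ge.
move=> [x y] /= [xs _].
have := le_trans (le_Re_normc _) xs; have := le_trans (le_Im_normc _) xs.
case: (c) => a1 b1 /=; rewrite !ler_distl => yy xx.
by split; rewrite /= in_itv.
Qed.

(** The half-plane Re w >= 1 corresponds under the Cayley map to a disk that is
    tangent to the unit circle at 1. *)
Lemma horodisk_ge1 (R : realType) (z : R[i]) : unit_disk z ->
  (normc (z - 2^-1%:C) <= 2^-1) = (1 <= (1 - normc z ^+ 2) / normc (1 - z) ^+ 2).
Proof.
move=> /normc_sub1_gt0 z1.
rewrite ler_pdivlMr ?exprn_gt0// mul1r -(@ler_pXn2r _ 2)// ?nnegrE ?ge0_normc ?invr_ge0//.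
rewrite !sqr_normc_def; case: (z) => x y /=.
by apply/idP/idP => ?; lra.
Qed.

(** Outside the horodisk |z - 1/2| <= 1/2 the bound on S h suffices.  Inside, h may
    only be large near 1, where it is at most M / |1 - z|.  The factor
    ((1 - z) / (1 + eps - z))^2 has modulus at most 1 and vanishes to second order
    at 1, so it brings h below M near 1 as well; the maximum principle
    applies to the product on the horodisk with a small neighbourhood of 1 removed,
    and eps tends to 0 afterwards. *)
Lemma phragmen_lindelof (R : realType) (h : R[i] -> R[i]) (M : R) :
  holomorphic_on_disk h ->
  (forall z, unit_disk z -> normc ((1 - z) * h z) <= M) ->
  (forall z, unit_disk z -> normc (singular_inner z * h z) <= M) ->
  forall z, unit_disk z -> normc (h z) <= M * expR 1.
Proof.
move=> dh hM1 hM2.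
have M0 : 0 <= M.
  apply: le_trans (hM1 0 _); first exact: ge0_normc.
  by rewrite /unit_disk/= expr0n addr0 sqrtr0.
have e1 : 1 <= expR 1 :> R by rewrite -expR0 ler_expR.
have outer z : unit_disk z ->
    (1 - normc z ^+ 2) / normc (1 - z) ^+ 2 <= 1 -> normc (h z) <= M * expR 1.
  move=> z1 t1; have := hM2 _ z1; rewrite normcM normc_singular_inner// expRN.
  rewrite mulrC ler_pdivrMr ?expR_gt0// => /le_trans; apply.
  by rewrite ler_wpM2l// ler_expR.
move=> z0 z01.
have [|t1] := leP ((1 - normc z0 ^+ 2) / normc (1 - z0) ^+ 2) 1; first exact: outer.
have inK : normc (z0 - 2^-1%:C) <= 2^-1 by rewrite horodisk_ge1// ltW.
have n0 := normc_sub1_gt0 z01; set n := normc (1 - z0) in n0.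
have key eps : 0 < eps -> eps <= 1 ->
    normc (h z0) * n ^+ 2 <= M * expR 1 * (n + eps) ^+ 2.
  move=> eps0 eps1.
  (* On |z - 1| <= rho the product is at most M rho / eps^2 <= M; the minimum with
     n keeps z0 in K. *)
  pose rho := Num.min (eps ^+ 2) n.
  have rho0 : 0 < rho by rewrite lt_min exprn_gt0.
  pose K := [set p : R * R | normc (p.1 +i* p.2 - 2^-1%:C) <= 2^-1 /\
                             rho <= normc (p.1 +i* p.2 - 1)].
  pose F z := h z * ((1 - z) * ((1 + eps)%:C - z)^-1) ^+ 2.
  have distC1 (z : R[i]) : normc (z - 1) = normc (1 - z) by rewrite -normcN opprB.
  have Kdisk p : K p -> unit_disk (p.1 +i* p.2).
    case: p => x y [Kz1 Kz2]; pose z := x +i* y.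
    have {}Kz1 : normc (z - 2^-1%:C) <= 2^-1 := Kz1.
    have {}Kz2 : rho <= normc (z - 1) := Kz2.
    suff : normc z < 1 by [].
    rewrite -(@ltr_pXn2r _ 2)// ?nnegrE ?ge0_normc//.
    move: Kz1; rewrite -(@ler_pXn2r _ 2)// ?nnegrE ?ge0_normc ?invr_ge0//.
    have : 0 < normc (z - 1) ^+ 2 by rewrite exprn_gt0// (lt_le_trans rho0).
    rewrite !sqr_normc_def /=; lra.
  have ge_eps z : unit_disk z -> eps <= normc ((1 + eps)%:C - z).
    move=> /Re_lt1_disk z1; apply: (le_trans _ (le_Re_normc _)).
    apply: (le_trans _ (ler_norm _)); move: z1; case: (z) => x y /=; lra.
  have ge_sub z : unit_disk z -> normc (1 - z) <= normc ((1 + eps)%:C - z).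
    move=> /Re_lt1_disk z1; rewrite -(@ler_pXn2r _ 2)// ?nnegrE ?ge0_normc//.
    rewrite !sqr_normc_def; move: z1; case: (z) => x y /= x1; nra.
  have den0 z : unit_disk z -> 0 < normc ((1 + eps)%:C - z).
    by move=> /ge_eps; exact: lt_le_trans.
  have normF z : normc (F z) =
      normc (h z) * (normc (1 - z) / normc ((1 + eps)%:C - z)) ^+ 2.
    by rewrite /F expr2 !normcM normcV expr2.
  have dF p : K p -> derivable (F : R[i]^o -> R[i]^o) (p.1 +i* p.2) 1.
    move=> /Kdisk pD; apply: (derivable_mulC (f := h)); first exact: dh.
    have dq : derivable ((fun z => (1 - z) * ((1 + eps)%:C - z)^-1) : R[i]^o -> R[i]^o)
        (p.1 +i* p.2) 1.
      apply: (@derivable_mulC _ (fun z => 1 - z) (fun z => ((1 + eps)%:C - z)^-1)).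
        exact: derivable_cst_sub.
      apply: (@derivableV R[i] R[i]^o (fun z => (1 + eps)%:C - z)); last first.
        exact: derivable_cst_sub.
      by apply: contraTneq (den0 _ pD) => ->; rewrite normc0 ltxx.
    exact: (derivable_mulC dq dq).
  have bnd p : K p -> normc (F (p.1 +i* p.2)) <= M * expR 1 \/
     exists2 r, 0 < r & forall z, normc (z - p.1 +i* p.2) <= r -> K (Re z, Im z).
    move=> Kp; have pD := Kdisk _ Kp; have [K1 K2] := Kp.
    set z := p.1 +i* p.2 in pD K1 K2 *.
    have q1 : normc (1 - z) / normc ((1 + eps)%:C - z) <= 1.
      by rewrite ler_pdivrMr ?den0// mul1r ge_sub.
    have q0 : 0 <= normc (1 - z) / normc ((1 + eps)%:C - z).
      by rewrite divr_ge0 ?ge0_normc.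
    have [t1'|t1'] := leP ((1 - normc z ^+ 2) / normc (1 - z) ^+ 2) 1.
      left; rewrite normF -[leRHS]mulr1; apply: ler_pM; rewrite ?ge0_normc ?exprn_ge0//.
        exact: outer.
      by rewrite exprn_ile1.
    have [r1|r1] := leP (normc (z - 1)) rho.
      left; rewrite normF; apply: (@le_trans _ _ M); last by rewrite ler_peMr.
      have := hM1 _ pD; rewrite normcM => hm.
      have -> : normc (h z) * (normc (1 - z) / normc ((1 + eps)%:C - z)) ^+ 2 =
         (normc (1 - z) * normc (h z)) * (normc (1 - z) / normc ((1 + eps)%:C - z) ^+ 2).
        by field; rewrite gt_eqF// den0.
      rewrite -[leRHS]mulr1; apply: ler_pM => //.
      - by rewrite mulr_ge0 ?ge0_normc.
      - by rewrite divr_ge0 ?exprn_ge0 ?ge0_normc.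
      rewrite ler_pdivrMr ?exprn_gt0 ?den0// mul1r -distC1.
      apply: (le_trans r1); apply: (@le_trans _ _ (eps ^+ 2)).
        by rewrite ge_min lexx.
      by rewrite ler_pXn2r ?nnegrE ?ge0_normc ?(ltW eps0)// ge_eps.
    right; exists (Num.min (2^-1 - normc (z - 2^-1%:C)) (normc (z - 1) - rho)).
      rewrite lt_min !subr_gt0 r1 andbT lt_neqAle K1 andbT.
      apply: contraTneq t1' => E; rewrite -leNgt.
      move: E => /(congr1 (fun x => x ^+ 2)); have nz := normc_sub1_gt0 pD.
      rewrite ler_pdivrMr ?exprn_gt0// mul1r !sqr_normc_def; case: (z) => x y /=; lra.
    move=> w; rewrite le_min => /andP[w1 w2].
    have -> : K (Re w, Im w) = (normc (w - 2^-1%:C) <= 2^-1 /\ rho <= normc (w - 1)).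
      by rewrite /K /=; case: (w).
    split.
      have := le_normcD (w - z) (z - 2^-1%:C); rewrite addrA subrK; lra.
    have := le_normcD (z - w) (w - 1); rewrite addrA subrK -(normcN (z - w)) opprB; lra.
  have B0 : 0 <= M * expR 1 by rewrite mulr_ge0 ?expR_ge0.
  have zE : Re z0 +i* Im z0 = z0 by case: (z0).
  have : K (Re z0, Im z0) -> normc (F (Re z0 +i* Im z0)) <= M * expR 1 :=
    @maximum_modulus R K F _ (@compact_disk_minus_disk R _ _ _ _) B0 dF bnd _.
  rewrite zE normF.
  have Kz0 : K (Re z0, Im z0).
    suff : normc (Re z0 +i* Im z0 - 2^-1%:C) <= 2^-1 /\
           rho <= normc (Re z0 +i* Im z0 - 1) by [].
    by rewrite zE; split => //; rewrite distC1 ge_min lexx orbT.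
  move=> /(_ Kz0); rewrite expr_div_n mulrA ler_pdivrMr ?exprn_gt0 ?den0//.
  move=> /le_trans; apply; rewrite ler_wpM2l//.
  rewrite ler_pXn2r ?nnegrE ?ge0_normc ?addr_ge0 ?(ltW n0) ?(ltW eps0)//.
  have -> : (1 + eps)%:C - z0 = (1 - z0) + eps%:C.
    apply/eqP; rewrite eq_complex; case: (z0) => x y /=.
    by apply/andP; split; apply/eqP; ring.
  apply: (le_trans (le_normcD _ _)); rewrite lerD2l /= expr0n addr0 sqrtr_sqr.
  by rewrite gtr0_norm.
rewrite -(@ler_pM2r _ (n ^+ 2)) ?exprn_gt0//; apply/ler_addgt0Pr => e e0.
set B := M * expR 1 in key *.
have B0 : 0 <= B by rewrite mulr_ge0 ?expR_ge0.
pose C := B * (2 * n + 1).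
have C0 : 0 <= C by rewrite mulr_ge0// addr_ge0// mulr_ge0// ltW.
pose eps := Num.min 1 (e / (C + 1)).
have C1 : 0 < C + 1 by lra.
have eps0 : 0 < eps by rewrite lt_min ltr01 divr_gt0.
have eps1 : eps <= 1 by rewrite ge_min lexx.
have epsC : eps * (C + 1) <= e by rewrite -ler_pdivlMr// ge_min lexx orbT.
apply: (le_trans (key _ eps0 eps1)).
have : eps * eps <= eps * 1 by rewrite ler_pM2l.
rewrite mulr1 => ee; have := ler_wpM2l B0 ee.
move: epsC; rewrite /C; lra.
Qed.

(** * Measurability and closure properties of the Bergman space *)

(** An open set of the plane is the union of the boxes with rational data that it
    contains, and these are countably many. *)
Lemma open_measurable_pair (R : realType) (O : set (R * R)) :
  open O -> measurable (O : set (measurableTypeR R * measurableTypeR R)).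
Proof.
move=> oO.
pose box (q : (rat * rat) * (rat * rat)) : set (R * R) :=
  ball (ratr q.1.1 : R) (ratr q.1.2) `*` ball (ratr q.2.1 : R) (ratr q.2.2).
have -> : O = \bigcup_(q in [set q | box q `<=` O]) box q.
  apply/seteqP; split => [p Op|p [q qO pq]]; last exact: qO.
  have /nbhs_ballP[e /= e0 eO] : nbhs p O by exact: open_nbhs_nbhs.
  have center (x : R) : x \in (ball x e : set R) by rewrite inE; exact: ballxx.
  have [c1 [r1 [p1 s1]]] := open_subball_rat (ball_open p.1 e) (center p.1).
  have [c2 [r2 [p2 s2]]] := open_subball_rat (ball_open p.2 e) (center p.2).
  exists ((c1, r1), (c2, r2)); last by split; exact: set_mem.
  by move=> t [t1 t2]; apply: eO; split; [exact: s1|exact: s2].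
rewrite bigcup_mkcond; apply: countable_bigcupT_measurable => // q.
case: ifP => // _; apply: measurableX; exact: (open_measurable (ball_open _ _)).
Qed.

Lemma continuous_measurable_pair (R : realType) (D : set (R * R)) (f : R * R -> R) :
  open D -> (forall p, D p -> {for p, continuous f}) ->
  measurable_fun (D : set (measurableTypeR R * measurableTypeR R))
    (f : _ -> measurableTypeR R).
Proof.
move=> oD cf; apply: (measurability _ (RGenOpens.measurableE R)).
move=> _ [_ [a [b ->] <-]]; apply: open_measurable_pair.
rewrite openE => p [Dp fp]; apply: filterI.
  exact: open_nbhs_nbhs.
by apply: (cf _ Dp); apply: open_nbhs_nbhs; split => //; exact: interval_open.
Qed.

Definition disk_pair (R : realType) : set (R * R) :=
  [set p | unit_disk (p.1 +i* p.2)].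

Lemma open_disk_pair (R : realType) : open (@disk_pair R).
Proof.
have -> : @disk_pair R = (fun p : R * R => normc (p.1 +i* p.2 - 0)) @^-1` [set x | x < 1].
  by apply/funext => p; rewrite /preimage /disk_pair /unit_disk /mkset subr0.
apply: open_comp; last exact: open_lt.
by move=> p _; exact: continuous_normc_pair.
Qed.

Lemma measurable_disk_pair (R : realType) :
  measurable (@disk_pair R : set (measurableTypeR R * measurableTypeR R)).
Proof. by apply: open_measurable_pair; exact: open_disk_pair. Qed.

Lemma measurable_sqnormc (R : realType) (f : R[i] -> R[i]) :
  holomorphic_on_disk f ->
  measurable_fun (@disk_pair R : set (measurableTypeR R * measurableTypeR R))
    (fun p => (normc (f (p.1 +i* p.2)) ^+ 2)%:E).
Proof.
move=> df; apply/measurable_EFinP; apply: continuous_measurable_pair.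
  exact: open_disk_pair.
move=> p Dp.
have -> : (fun p => normc (f (p.1 +i* p.2)) ^+ 2) =
    (fun p : R * R => Re (f (p.1 +i* p.2)) ^+ 2 + Im (f (p.1 +i* p.2)) ^+ 2).
  by apply/funext => t; rewrite sqr_normc_def.
have [cR cI] := continuous_ReIm_pair (df _ Dp).
by apply: cvgD; apply: cvgM; first [exact: cR|exact: cI].
Qed.

Lemma bergmanD (R : realType) (f g : R[i] -> R[i]) :
  bergman f -> bergman g -> bergman (fun z => f z + g z).
Proof.
move=> [df Af] [dg Ag].
have dfg : holomorphic_on_disk (fun z => f z + g z).
  by move=> z z1; apply: (@derivableD R[i] R[i]^o R[i]^o f g z 1); [exact: df|exact: dg].
split=> //.
apply: (@le_lt_trans _ _ (2%:E * (bergman_sqnorm f + bergman_sqnorm g))%E); last first.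
  by rewrite lte_mul_pinfty// lte_add_pinfty.
rewrite /bergman_sqnorm -ge0_integralD//; last 5 first.
- exact: measurable_disk_pair.
- by move=> p _; rewrite lee_fin exprn_ge0// ge0_normc.
- exact: measurable_sqnormc.
- by move=> p _; rewrite lee_fin exprn_ge0// ge0_normc.
- exact: measurable_sqnormc.
have mD := @measurable_disk_pair R.
rewrite -ge0_integralZl//; last 2 first.
- exact: (emeasurable_funD (measurable_sqnormc df) (measurable_sqnormc dg)).
- by move=> p _; rewrite adde_ge0// lee_fin exprn_ge0// ge0_normc.
apply: ge0_le_integral => //.
- by move=> p _; rewrite lee_fin exprn_ge0// ge0_normc.
- exact: (measurable_sqnormc dfg).
- apply: measurable_funeM.
  exact: (emeasurable_funD (measurable_sqnormc df) (measurable_sqnormc dg)).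
move=> p _; rewrite -EFinD -EFinM lee_fin.
set a := normc (f _); set b := normc (g _).
have : normc (f (p.1 +i* p.2) + g (p.1 +i* p.2)) ^+ 2 <= (a + b) ^+ 2.
  by rewrite ler_pXn2r ?nnegrE ?addr_ge0 ?ge0_normc// le_normcD.
by have := sqr_ge0 (a - b); lra.
Qed.

Lemma bergman0 (R : realType) : bergman (fun=> 0 : R[i]).
Proof.
split; first by move=> z _; exact: (@derivable_cst R[i] R[i]^o R[i]^o).
by rewrite /bergman_sqnorm integral0_eq// => p _; rewrite normc0 expr0n.
Qed.

Lemma bergmanM (R : realType) (h f : R[i] -> R[i]) :
  Hinfty h -> bergman f -> bergman (fun z => h z * f z).
Proof.
move=> [dh [M hM]] [df Af].
have dhf : holomorphic_on_disk (fun z => h z * f z).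
  by move=> z z1; apply: derivable_mulC; [exact: dh|exact: df].
have mD := @measurable_disk_pair R.
split=> //; apply: (@le_lt_trans _ _ ((M ^+ 2)%:E * bergman_sqnorm f)%E); last first.
  by rewrite lte_mul_pinfty// lee_fin sqr_ge0.
rewrite /bergman_sqnorm -ge0_integralZl//; last 3 first.
- exact: measurable_sqnormc.
- by move=> p _; rewrite lee_fin exprn_ge0// ge0_normc.
- by rewrite lee_fin sqr_ge0.
apply: ge0_le_integral => //.
- by move=> p _; rewrite lee_fin exprn_ge0// ge0_normc.
- exact: (measurable_sqnormc dhf).
- by apply: measurable_funeM; exact: measurable_sqnormc.
move=> p pD; rewrite -EFinM lee_fin normcM exprMn ler_wpM2r ?exprn_ge0 ?ge0_normc//.
have := hM _ pD; have := ge0_normc (h (p.1 +i* p.2)); move: (normc _) => a; nra.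
Qed.

Lemma bergman_sum (R : realType) (k : nat) (f : 'I_k -> R[i] -> R[i]) :
  (forall j, bergman (f j)) -> bergman (fun z => \sum_(j < k) f j z).
Proof.
elim: k f => [|k IH] f bf.
  by under eq_fun do rewrite big_ord0; exact: bergman0.
under eq_fun do rewrite big_ord_recl.
by apply: bergmanD => //; apply: (IH (fun j => f (lift ord0 j))).
Qed.

Lemma eq_bergman_sqnorm (R : realType) (f g : R[i] -> R[i]) :
  (forall z, unit_disk z -> f z = g z) -> bergman_sqnorm f = bergman_sqnorm g.
Proof. by move=> fg; apply: eq_integral => p; rewrite inE => pD; rewrite fg. Qed.

(** * Integrability of the pole at 1 *)

(** The integrand is dominated by the sum of c n times the indicator of A n, so the
    layers A n may overlap. *)
Lemma ge0_integral_cover d (T : measurableType d) (R : realType)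
    (mu : {measure set T -> \bar R}) (D : set T) (f : T -> R)
    (A : nat -> set T) (c : nat -> R) :
  measurable D -> (forall n, measurable (A n)) -> (forall n, 0 <= c n) ->
  measurable_fun D (fun x => (f x)%:E) -> (forall x, D x -> 0 <= f x) ->
  (forall x, D x -> exists2 n, A n x & f x <= c n) ->
  (\int[mu]_(x in D) (f x)%:E <= \sum_(n <oo) (c n)%:E * mu (A n))%E.
Proof.
move=> mD mA c0 mf f0 cover.
have mcA n : measurable_fun D (fun x => ((c n)%:E * (\1_(A n) x)%:E)%E).
  by apply: measurable_funeM; apply/measurable_EFinP; exact: measurable_indic.
have cA0 n x : (0 <= (c n)%:E * (\1_(A n) x)%:E)%E.
  by rewrite -EFinM lee_fin mulr_ge0// indicE; case: (_ \in _).
apply: (@le_trans _ _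
    (\int[mu]_(x in D) \sum_(n <oo) (c n)%:E * (\1_(A n) x)%:E)%E).
  apply: ge0_le_integral => //.
    by apply: ge0_emeasurable_sum => // n x _ _; exact: cA0.
  move=> x Dx; have [n Anx fc] := cover x Dx.
  apply: (@le_trans _ _ (\sum_(0 <= k < n.+1) (c k)%:E * (\1_(A k) x)%:E)%E); last first.
    exact: nneseries_lim_ge.
  rewrite big_nat_recr//= indicE mem_set// mule1.
  rewrite -[leLHS]add0e leeD//.
  by apply: sume_ge0 => k _; exact: cA0.
rewrite integral_nneseries//; apply: lee_nneseries => n _.
  by move=> _; apply: integral_ge0 => x _; exact: cA0.
rewrite ge0_integralZl ?lee_fin//; last first.
  by apply/measurable_EFinP; exact: measurable_indic.
rewrite integral_indic// lee_wpmul2l ?lee_fin//.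
by apply: le_measure; rewrite ?inE//; exact: measurableI.
Qed.

Section pole_at_one.
Variable R : realType.
Local Notation area := (@lebesgue_measure R \x @lebesgue_measure R)%E.

Lemma area_rect (x0 x1 y0 y1 : R) : x0 <= x1 -> y0 <= y1 ->
  area (`]x0, x1] `*` `]y0, y1]) = ((x1 - x0) * (y1 - y0))%:E.
Proof.
have len (a b : R) : a <= b -> lebesgue_measure `]a, b] = (b - a)%:E.
  move=> ab; rewrite lebesgue_measure_itv/= lte_fin.
  by case: ltgtP ab => //= -> _; rewrite subrr.
move=> x01 y01; rewrite product_measure1E//.
by rewrite [X in (X * _)%E]len// [X in (_ * X)%E]len.
Qed.

Lemma measurable_rect (x0 x1 y0 y1 : R) :
  measurable (`]x0, x1] `*` `]y0, y1] : set (measurableTypeR R * measurableTypeR R)).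
Proof. by apply: measurableX; exact: measurable_itv. Qed.

Lemma holomorphic_pole : holomorphic_on_disk (fun z : R[i] => (1 - z)^-1).
Proof.
move=> z z1; apply: (@derivableV R[i] R[i]^o (fun z => 1 - z)).
  exact: sub1_neq0_disk.
exact: derivable_cst_sub.
Qed.

(** With X = 1 - Re z, the square modulus of the pole is 1 / (X^2 + y^2).  The
    squares a <= X < 2 a, 0 < y <= a for a = 2^-(n+1) lie in the disk, are disjoint,
    have area a^2, and on them it is at least 1 / (5 a^2). *)
Lemma pole_not_bergman : ~ bergman (fun z : R[i] => (1 - z)^-1).
Proof.
move=> [_ fin_pole].
pose a n : R := 2^-1 ^+ n.+1.
have a0 n : 0 < a n by rewrite exprn_gt0// invr_gt0.
have a1 n : 2 * a n <= 1.
  by rewrite /a exprS mulrA mulfV// mul1r exprn_ile1 ?invr_ge0// invf_le1 ?ler1n.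
pose Q n : set (R * R) := `]1 - 2 * a n, 1 - a n] `*` `]0, a n].
have Qarea n : area (Q n) = (a n ^+ 2)%:E.
  rewrite area_rect; [|by have := a0 n; lra|exact: ltW].
  by congr EFin; ring.
have QP n p : Q n p -> [/\ 1 - 2 * a n < p.1, p.1 <= 1 - a n, 0 < p.2 & p.2 <= a n].
  by move=> [/=]; rewrite !in_itv/= => /andP[? ?] /andP[? ?].
have QD n : Q n `<=` @disk_pair R.
  move=> p /QP[p1 p2 p3 p4]; suff : normc (p.1 +i* p.2) < 1 by [].
  rewrite -(@ltr_pXn2r _ 2)// ?nnegrE ?ge0_normc// sqr_normc_def/=.
  have := a0 n; have := a1 n; nra.
have Qdisj : trivIset setT Q.
  have lt_a i j : (i < j)%N -> 2 * a j <= a i.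
    move=> ij; rewrite /a exprS mulrA mulfV// mul1r.
    by rewrite ler_wiXn2l ?invr_ge0// invf_le1 ?ler1n.
  have far i j p : Q i p -> Q j p -> ~~ (i < j)%N.
    move=> /QP[_ p2 _ _] /QP[p1 _ _ _]; apply/negP => /lt_a; lra.
  move=> i j _ _ [p [Qi Qj]]; case: (ltngtP i j) => // ij.
    by have := far _ _ _ Qi Qj; rewrite ij.
  by have := far _ _ _ Qj Qi; rewrite ij.
have mQ n : measurable (Q n : set (measurableTypeR R * measurableTypeR R)).
  exact: measurable_rect.
have mf := measurable_sqnormc holomorphic_pole.
have ge n : ((5^-1)%:E <= \int[area]_(p in Q n) (normc (1 - p.1 +i* p.2)^-1 ^+ 2)%:E)%E.
  apply: (@le_trans _ _ (\int[area]_(p in Q n) ((5 * a n ^+ 2)^-1)%:E)%E).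
    rewrite integral_cst// [X in (_ * X)%E]Qarea -EFinM lee_fin.
    by rewrite invfM -mulrA mulVf ?mulr1// gt_eqF// exprn_gt0.
  apply: ge0_le_integral => //.
  - by move=> p _; rewrite lee_fin invr_ge0 mulr_ge0 ?sqr_ge0.
  - exact: (measurable_funS (@measurable_disk_pair R) (@QD n) mf).
  move=> p /[dup] /QD pD /QP[p1 p2 p3 p4]; rewrite lee_fin.
  have z1 := normc_sub1_gt0 pD.
  rewrite normcV exprVn lef_pV2 ?posrE ?exprn_gt0//; last first.
    by rewrite mulr_gt0 ?exprn_gt0.
  rewrite sqr_normc_def /=; have := a0 n; nra.
have : (\sum_(n <oo) \int[area]_(p in Q n) (normc (1 - p.1 +i* p.2)^-1 ^+ 2)%:E < +oo)%E.
  apply: le_lt_trans fin_pole; rewrite -ge0_integral_bigcup//.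
  - apply: ge0_subset_integral => //.
    + exact: bigcup_measurable.
    + exact: measurable_disk_pair.
    + by move=> p _; rewrite lee_fin exprn_ge0// ge0_normc.
    + by move=> p [n _]; exact: QD.
  - apply: (measurable_funS (@measurable_disk_pair R) _ mf).
    by move=> p [n _]; exact: QD.
  - by move=> p _; rewrite lee_fin exprn_ge0// ge0_normc.
set S := (\sum_(n <oo) _)%E => Sfin.
have SN N : ((N%:R / 5)%:E <= S)%E.
  apply: (@le_trans _ _ (\sum_(0 <= n < N)
      \int[area]_(p in Q n) (normc (1 - p.1 +i* p.2)^-1 ^+ 2)%:E)%E); last first.
    apply: nneseries_lim_ge => n _ _; apply: integral_ge0 => p _.
    by rewrite lee_fin exprn_ge0// ge0_normc.
  elim: N => [|N IH]; first by rewrite big_nil mul0r.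
  rewrite big_nat_recr//= -natr1 mulrDl mul1r EFinD; exact: leeD.
have := SN (Num.bound (5 * fine S)).
have S0 : (0 <= S)%E by apply: le_trans (SN 0%N); rewrite mul0r.
rewrite -[X in (_ <= X)%E]fineK ?ge0_fin_numE// lee_fin ler_pdivrMr// mulrC leNgt.
by rewrite archi_boundP// mulr_ge0// fine_ge0.
Qed.

(** With t = Re ((1 + z) / (1 - z)) >= 0 one has |1 - z|^2 (1 + t) = 2 (1 - Re z),
    and |S|^2 = e^(- 2 t) <= 1 / (1 + t)^2 turns |S|^2 / |1 - z|^2 into
    |1 - z|^2 / (2 (1 - Re z))^2, where |1 - z|^2 <= 2 (1 - Re z). *)
Lemma sqnormc_singular_pole (z : R[i]) : unit_disk z ->
  normc (singular_inner z * (1 - z)^-1) ^+ 2 <= (2 * (1 - Re z))^-1.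
Proof.
move=> zD; have z1 := normc_sub1_gt0 zD.
have X0 : 0 < 1 - Re z by rewrite subr_gt0 Re_lt1_disk.
rewrite normcM normcV normc_singular_inner// expRN -invfM exprVn.
rewrite lef_pV2 ?posrE ?mulr_gt0// ?exprn_gt0 ?mulr_gt0 ?expR_gt0//.
set t := (1 - _) / _.
have t1 : normc (1 - z) ^+ 2 * (1 + t) = 2 * (1 - Re z).
  rewrite mulrDr mulr1 /t mulrC mulrC mulrCA mulfV ?mulr1 ?gt_eqF ?exprn_gt0//.
  by rewrite !sqr_normc_def; case: (z) => x y /=; ring.
have t0 : 0 <= t.
  rewrite divr_ge0 ?exprn_ge0 ?ge0_normc// subr_ge0 exprn_ile1 ?ge0_normc//.
  exact: ltW.
have le_exp : 1 + t <= expR t := expR_ge1Dx t.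
have : (1 + t) ^+ 2 <= expR t ^+ 2 by rewrite ler_pXn2r ?nnegrE ?expR_ge0//; lra.
have n2 : 0 < normc (1 - z) ^+ 2 by rewrite exprn_gt0.
rewrite exprMn -(ler_pM2r n2); apply: le_trans.
have -> : (1 + t) ^+ 2 * normc (1 - z) ^+ 2 =
    (1 + t) * (normc (1 - z) ^+ 2 * (1 + t)) by ring.
rewrite t1; have := mulr_ge0 t0 (ltW X0); lra.
Qed.

(** With X = 1 - Re z, the disk lies in y^2 < 2 X: at distance X from the line
    Re z = 1 it has width of order sqrt X, so the bound 1 / (2 X) is integrable.
    The layer q (n+1) <= X < q n, with q n = 2 / 4^n, contributes 6 / 2^n. *)
Lemma bergman_singular_pole :
  bergman (fun z : R[i] => singular_inner z * (1 - z)^-1).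
Proof.
have hol : holomorphic_on_disk (fun z : R[i] => singular_inner z * (1 - z)^-1).
  move=> z zD; apply: derivable_mulC; first exact: holomorphic_singular_inner.
  exact: holomorphic_pole.
split=> //.
pose q n : R := 2 * 4^-1 ^+ n.
pose b n : R := 2 * 2^-1 ^+ n.
pose A n : set (R * R) := `]1 - q n, 1 - q n.+1] `*` `]- b n, b n].
have q0 n : 0 < q n by rewrite mulr_gt0// exprn_gt0// invr_gt0.
have b0 n : 0 < b n by rewrite mulr_gt0// exprn_gt0// invr_gt0.
have qS n : q n = 4 * q n.+1 by rewrite /q exprS; field.
have bq n : b n ^+ 2 = 2 * q n.
  have four : (2^-1) ^+ 2 = 4^-1 :> R by rewrite exprVn -natrX.
  by rewrite /b /q exprMn -exprM mulnC exprM four mulrA -expr2.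
apply: (@le_lt_trans _ _ 12%:E); last exact: ltry.
apply: (@le_trans _ _ (\sum_(n <oo) ((2 * q n.+1)^-1)%:E * area (A n))%E).
  apply: ge0_integral_cover.
  - exact: measurable_disk_pair.
  - by move=> n; exact: measurable_rect.
  - by move=> n; rewrite invr_ge0 mulr_ge0// ltW.
  - exact: (measurable_sqnormc hol).
  - by move=> p _; rewrite exprn_ge0// ge0_normc.
  move=> p pD; have X0 : 0 < 1 - p.1 by rewrite subr_gt0; exact: (Re_lt1_disk pD).
  have p1 : p.1 ^+ 2 + p.2 ^+ 2 < 1.
    rewrite -(sqr_normc_def (p.1 +i* p.2)) -[ltRHS](expr1n _ 2).
    by rewrite ltr_pXn2r ?nnegrE ?ge0_normc.
  have exq : exists n, q n.+1 <= 1 - p.1.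
    exists (Num.bound (2 / (1 - p.1))).
    set N := Num.bound _.
    rewrite /q exprVn ler_pdivrMr ?exprn_gt0// mulrC -ler_pdivrMr//.
    apply: (@le_trans _ _ N%:R).
      by rewrite ltW// archi_boundP// divr_ge0// ltW.
    by rewrite -natrX ler_nat ltnW// (ltn_trans (ltnSn N))// ltn_expl.
  have [n qn nmin] := ex_minnP exq.
  have qn' : 1 - p.1 < q n.
    case: n {qn} nmin => [_|n nmin]; first by rewrite /q expr0 mulr1; nra.
    by rewrite ltNge; apply/negP => /nmin; rewrite ltnn.
  exists n; last first.
    apply: (le_trans (sqnormc_singular_pole pD)).
    by rewrite lef_pV2 ?posrE ?mulr_gt0// ler_pM2l.
  have : `|p.2| < b n.
    rewrite -(@ltr_pXn2r _ 2)// ?nnegrE ?(ltW (b0 n))// bq real_normK ?num_real//.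
    nra.
  rewrite ltr_norml => /andP[y1 y2].
  by split; rewrite /= in_itv/=; apply/andP; split; lra.
apply: (le_trans _ (@epsilon_trick0 R 12 xpredT _)) => //.
apply: lee_nneseries => n _.
  by move=> _; rewrite mule_ge0// lee_fin invr_ge0 mulr_ge0// ltW.
rewrite area_rect; last 2 first.
- by have := q0 n.+1; have := qS n; lra.
- by have := b0 n; lra.
rewrite -EFinM lee_fin natrX (qS n).
have q1 : q n.+1 != 0 by rewrite gt_eqF.
have -> : 12 / 2 ^+ n.+1 = 3 * b n by rewrite /b exprS exprVn; field.
suff -> : (2 * q n.+1)^-1 *
  ((1 - q n.+1 - (1 - 4 * q n.+1)) * (b n - - b n)) = 3 * b n by [].
by field.
Qed.

End pole_at_one.

(** * Failure of the factorization *)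

Lemma Hinfty_bergman (R : realType) (f : R[i] -> R[i]) : Hinfty f -> bergman f.
Proof.
move=> Hf; suff one : bergman (fun=> 1 : R[i]).
  have [dff fin_f] := bergmanM Hf one; split; first by have [] := Hf.
  apply: le_lt_trans fin_f; rewrite (@eq_bergman_sqnorm _ f (fun z => f z * 1))//.
  by move=> z _; rewrite mulr1.
have dc : holomorphic_on_disk (fun=> 1 : R[i]).
  by move=> z _; exact: (@derivable_cst R[i] R[i]^o R[i]^o).
split=> //; have m := @measurable_disk_pair R.
apply: (@le_lt_trans _ _ ((@lebesgue_measure R \x @lebesgue_measure R)%E (@disk_pair R))).
  rewrite /bergman_sqnorm -[leRHS]mul1e -integral_cst//.
  by apply: ge0_le_integral => // p _; rewrite normc1 expr1n.
apply: (@le_lt_trans _ _ ((2 * 2)%:E : \bar R)%E); last exact: ltry.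
have -> : (2 * 2 : R) = (1 - -1) * (1 - -1) by ring.
rewrite -area_rect; [|lra|lra].
apply: le_measure; rewrite ?inE//; first exact: measurable_rect.
move=> [x y] zD; have := le_Re_normc (x +i* y); have := le_Im_normc (x +i* y).
have : normc (x +i* y) < 1 by exact: zD.
rewrite /= => n1 /le_lt_trans/(_ n1) + /le_lt_trans/(_ n1).
rewrite !ltr_norml => /andP[y1 y2] /andP[x1 x2].
by split; rewrite /= in_itv/= ?x1 ?y1 ltW.
Qed.

(** The relation module of the pair (1 - z, - S) is generated by (S, 1 - z): a
    relation (a, b) is the multiple of this generator by the bounded function
    b / (1 - z). *)
Lemma Hinfty_quotient (R : realType) (a b : R[i] -> R[i]) :
  Hinfty a -> Hinfty b ->
  (forall z, unit_disk z -> (1 - z) * a z = singular_inner z * b z) ->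
  Hinfty (fun z => b z / (1 - z)).
Proof.
move=> [_ [Ma Ha]] [db [Mb Hb]] ab.
have hol : holomorphic_on_disk (fun z => b z / (1 - z)).
  by move=> z zD; apply: derivable_mulC; [exact: db|exact: holomorphic_pole].
split=> //; exists (Num.max Ma Mb * expR 1).
apply: phragmen_lindelof => // z zD.
  rewrite mulrCA mulfV ?sub1_neq0_disk// mulr1.
  by rewrite (le_trans (Hb _ zD))// le_max lexx orbT.
rewrite mulrA -ab// mulrAC mulfV ?sub1_neq0_disk// mul1r.
by rewrite (le_trans (Ha _ zD))// le_max lexx.
Qed.

Theorem theorem2p10 (R : realType) :
  exists (r f : 'I_2 -> R[i] -> R[i]),
    [/\ forall i, Hinfty (r i),
        forall i, bergman (f i),
        forall z, unit_disk z -> \sum_(i < 2) r i z * f i z = 0 &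
        ~ exists (k : nat) (theta : 'I_2 -> 'I_k -> R[i] -> R[i])
                 (mu : 'I_k -> R[i] -> R[i]),
            [/\ (0 < k)%N,
                forall i j, Hinfty (theta i j),
                forall j, bergman (mu j),
                forall (j : 'I_k) z, unit_disk z ->
                  \sum_(i < 2) r i z * theta i j z = 0 &
                forall (i : 'I_2) z, unit_disk z ->
                  f i z = \sum_(j < k) theta i j z * mu j z]].
Proof.
have HS : Hinfty (@singular_inner R).
  split; first exact: holomorphic_singular_inner.
  exists 1 => z zD; rewrite normc_singular_inner// -[leRHS]expR0 ler_expR oppr_le0.
  rewrite divr_ge0 ?exprn_ge0 ?ge0_normc// subr_ge0 exprn_ile1 ?ge0_normc//.
  exact: ltW.
have Hc (c : R[i]) : Hinfty (fun=> c).
  split; first by move=> z _; exact: (@derivable_cst R[i] R[i]^o R[i]^o).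
  by exists (normc c) => z _.
have H1 : Hinfty (fun z : R[i] => 1 - z).
  split; first by move=> z _; exact: derivable_cst_sub.
  exists (1 + 1) => z zD; apply: (le_trans (le_normcD _ _)).
  by rewrite normcN normc1 lerD2l ltW.
pose r (i : 'I_2) : R[i] -> R[i] :=
  if i == ord0 then (fun z => 1 - z) else (fun z => - singular_inner z).
pose f (i : 'I_2) : R[i] -> R[i] :=
  if i == ord0 then (fun z => singular_inner z * (1 - z)^-1) else (fun=> 1).
have sum2 (F : 'I_2 -> R[i]) : \sum_(i < 2) F i = F ord0 + F (lift ord0 ord0).
  by rewrite big_ord_recl big_ord1.
exists r, f; split.
- move=> i; rewrite /r; case: ifP => // _; split.
    by move=> z zD; apply: (@derivableN R[i] R[i]^o R[i]^o); exact: HS.1.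
  by have [_ [M HM]] := HS; exists M => z zD; rewrite normcN HM.
- move=> i; rewrite /f; case: ifP => _; first exact: bergman_singular_pole.
  by apply: Hinfty_bergman.
- move=> z zD; rewrite sum2 /r /f /= mulr1 mulrCA mulfV ?sub1_neq0_disk// mulr1.
  exact: subrr.
move=> [k [theta [mu [_ Htheta bmu rel fE]]]].
pose i0 : 'I_2 := ord0; pose i1 : 'I_2 := lift ord0 ord0.
pose h j z := theta i1 j z / (1 - z).
have Hh j : Hinfty (h j).
  apply: (Hinfty_quotient (Htheta i0 j) (Htheta i1 j)) => z zD.
  have := rel j z zD; rewrite sum2 /r /= mulNr => /eqP.
  by rewrite subr_eq0 => /eqP.
apply: (@pole_not_bergman R); split; first exact: holomorphic_pole.
have [_ fin_sum] := bergman_sum (fun j => bergmanM (Hh j) (bmu j)).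
rewrite (eq_bergman_sqnorm (g := fun z => \sum_(j < k) h j z * mu j z))// => z zD.
have := fE i1 z zD; rewrite /f /= => one.
rewrite -[LHS]mul1r [X in X * _]one mulr_suml; apply: eq_bigr => j _.
by rewrite /h mulrAC.
Qed.
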